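(* If a graph $G$ has a maximum independent set $S$ such that $S\subseteq\mathrm{Shed}(G)$, then $|\Omega(G)|\geq 2^{\alpha(G)}$, and there is some $I\in\Omega(G)$ that is disjoint from $S$.
   Context: All graphs are finite, undirected, without loops or multiple edges. $\alpha(G)$ is the maximum size of an independent set of $G$; a maximum independent set is an independent set of size $\alpha(G)$; $\Omega(G)$ is the family of all maximum independent sets of $G$. $N(v)$ is the set of neighbors of $v$ and $N[v]=N(v)\cup\{v\}$. A vertex $v$ of $G$ is a shedding vertex if for every independent set $I$ of $G-N[v]$ (including the empty set) there exists $u\in N(v)$ such that $I\cup\{u\}$ is independent; $\mathrm{Shed}(G)$ is the set of all shedding vertices of $G$. *)

(* Defs.v *)
From mathcomp Require Import all_boot.

Set Implicit Arguments.
Unset Strict Implicit.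
Unset Printing Implicit Defensive.

(* A finite simple graph is a symmetric irreflexive adjacency relation e on
   a finType T of vertices; the symmetry and irreflexivity are hypotheses of
   the statements, not of the definitions below. *)

Definition nbhd (T : finType) (e : rel T) (v : T) : {set T} :=
  [set u | e v u].

Definition closed_nbhd (T : finType) (e : rel T) (v : T) : {set T} :=
  v |: nbhd e v.

Definition independent (T : finType) (e : rel T) (A : {set T}) : bool :=
  [forall x in A, forall y in A, ~~ e x y].

Definition alpha (T : finType) (e : rel T) : nat :=
  \max_(A : {set T} | independent e A) #|A|.

Definition Omega (T : finType) (e : rel T) : {set {set T}} :=
  [set A | independent e A & #|A| == alpha e].

(* G - N[v] is an induced subgraph, so its independent sets are the
   independent sets of G that avoid N[v]. *)
Definition shedding (T : finType) (e : rel T) (v : T) : bool :=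
  [forall I : {set T},
     (I \subset ~: closed_nbhd e v) && independent e I ==>
     [exists u in nbhd e v, independent e (u |: I)]].

Definition Shed (T : finType) (e : rel T) : {set T} :=
  [set v | shedding e v].

(* Main.v *)
Require Import Defs.
From mathcomp Require Import all_boot.

(** Every subset A of S is the trace on S of some maximum independent set:
    starting from S itself, each unwanted vertex v of S is exchanged for a
    neighbour, which exists because v is shedding and lies outside S because S
    is independent.  Thus I |-> I :&: S maps Omega onto the powerset of S, and
    a preimage of the empty set is disjoint from S. *)

Lemma independentP (T : finType) (e : rel T) (A : {set T}) :
  reflect {in A &, forall x y, ~~ e x y} (independent e A).
Proof.
apply: (iffP forall_inP) => [indA x y xA yA | indA x xA].
  by move/forall_inP: (indA x xA) => /(_ y yA).
by apply/forall_inP => y yA; apply: indA.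
Qed.

Lemma independentS (T : finType) (e : rel T) (A B : {set T}) :
  A \subset B -> independent e B -> independent e A.
Proof.
move=> /subsetP sAB /independentP indB.
by apply/independentP => x y xA yA; apply: indB; apply: sAB.
Qed.

(** Since [I] is independent, [I :\ v] avoids the closed neighbourhood of [v], so shedding applies
    to it and yields [u]. Being adjacent to [v], this [u] is not in [I], so the swap preserves the
    cardinality. *)
Lemma shedding_exchange (T : finType) (e : rel T) (I : {set T}) (v : T) :
  shedding e v -> I \in Omega e -> v \in I ->
  exists2 u, e v u & u |: (I :\ v) \in Omega e.
Proof.
move=> /forallP/(_ (I :\ v))/implyP shed_v; rewrite inE => /andP[indI cardI] vI.
have ind_Iv : independent e (I :\ v) by apply: independentS indI; apply: subD1set.
have [|u] := exists_inP (shed_v _).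
  rewrite ind_Iv andbT; apply/subsetP => x; rewrite !inE => /andP[xv xI].
  by rewrite negb_or xv; apply: (independentP _ _ _ indI).
rewrite inE => evu ind_uI; exists u => //.
have uI : u \notin I by apply: contraL evu => uI; apply: (independentP _ _ _ indI).
by rewrite inE ind_uI cardsU1 !inE (negPf uI) andbF -(eqP cardI) (cardsD1 v I) vI /=.
Qed.

Lemma Omega_trace (T : finType) (e : rel T) (S A : {set T}) :
  S \in Omega e -> S \subset Shed e -> A \subset S ->
  exists2 I, I \in Omega e & I :&: S = A.
Proof.
(* Induction on the number of vertices of [S] still to be expelled. *)
move=> S_max S_shed; have [n] := ubnP #|S :\: A|.
elim: n A => // n IHn A ltn sAS.
have [/eqP|[v]] := set_0Vmem (S :\: A).
  rewrite setD_eq0 => sSA; exists S => //.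
  by rewrite setIid; apply/eqP; rewrite eqEsubset sSA sAS.
rewrite inE => /andP[vA vS].
(* Keeping [v] as well leaves one vertex fewer to expel; [v] is then exchanged last. *)
have [||I I_max trI] := IHn (v |: A).
- by rewrite setUC -setDDl; move: ltn; rewrite (cardsD1 v (S :\: A)) inE vA vS.
- by rewrite subUset sub1set vS.
have vI : v \in I by have := setU11 v A; rewrite -trI inE => /andP[].
have shed_v : shedding e v by have := subsetP S_shed v vS; rewrite inE.
have [u evu I'_max] := shedding_exchange _ _ _ _ shed_v I_max vI.
exists (u |: (I :\ v)) => //.
have uS : u \notin S.
  move: S_max; rewrite inE => /andP[/independentP indS _].
  by apply: contraL evu => uS; apply: indS.
(* As [u] lies outside [S], the new trace is [(v |: A) :\ v], which is [A] because [v] is not in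
   [A]. *)
by rewrite setIUl setIDAC trI setU1K // (disjoint_setI0 _) ?set0U ?disjoints1.
Qed.

Theorem corollary2p5 (T : finType) (e : rel T)
  (e_sym : symmetric e) (e_irr : irreflexive e)
  (S : {set T}) (S_max : S \in Omega e) (S_shed : S \subset Shed e) :
  2 ^ alpha e <= #|Omega e| /\
  exists I : {set T}, I \in Omega e /\ [disjoint I & S].
Proof.
split; last first.
  have [I I_max trI] := Omega_trace _ _ _ _ S_max S_shed (sub0set S).
  by exists I; rewrite -setI_eq0 trI.
have /eqP <- : #|S| == alpha e by move: S_max; rewrite inE => /andP[].
(* With the bound read as the size of [powerset S], it suffices that traces of members of [Omega e]
   cover this powerset. *)
rewrite -card_powerset.
apply: leq_trans (leq_imset_card (fun I => I :&: S) (Omega e)).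
apply/subset_leq_card/subsetP => A; rewrite inE => sAS.
have [I I_max trI] := Omega_trace _ _ _ _ S_max S_shed sAS.
by apply/imsetP; exists I.
Qed.
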